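(* Let $\alpha\vdash n$ be a partition of $n$. When $b_\alpha$ is written as a linear combination of the class elements $\Gamma_\lambda$ ($\lambda\vdash n$), the coefficient of the Coxeter class element $\Gamma_{(n)}$ in $b_\alpha$ is $\xi^{\,n-1-l_\alpha}$.
   Context: $S_n$ is the symmetric group with simple reflections $s_i=(i\ \ i+1)$, $1\le i\le n-1$, and length function $\ell$. The Iwahori--Hecke algebra $\mathcal H=\mathcal H_n$ is the associative $\mathbb Z[\xi]$-algebra ($\xi$ an indeterminate) with identity $\tilde T_1$, generated by $\tilde T_{s_1},\dots,\tilde T_{s_{n-1}}$ subject to the braid relations $\tilde T_{s_i}\tilde T_{s_j}=\tilde T_{s_j}\tilde T_{s_i}$ for $|i-j|\ge 2$, $\tilde T_{s_i}\tilde T_{s_{i+1}}\tilde T_{s_i}=\tilde T_{s_{i+1}}\tilde T_{s_i}\tilde T_{s_{i+1}}$, and $\tilde T_{s_i}^2=\tilde T_1+\xi\tilde T_{s_i}$. For a reduced expression $w=s_{i_1}\cdots s_{i_r}$ put $\tilde T_w=\tilde T_{s_{i_1}}\cdots\tilde T_{s_{i_r}}$; the $\tilde T_w$, $w\in S_n$, form a $\mathbb Z[\xi]$-basis. $Z(\mathcal H)$ is the centre. Specialization at $\xi=0$ gives the group algebra $\mathbb Z S_n$. A composition $\lambda=(\lambda_1,\dots,\lambda_r)$ of $n$ is a finite sequence of positive integers with sum $n$; it is a partition ($\lambda\vdash n$) if weakly decreasing. $S_\lambda=S_{\lambda_1}\times\cdots\times S_{\lambda_r}\le S_n$ is the standard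 parabolic subgroup, with $i$-th factor generated by $s_{\lambda_1+\dots+\lambda_{i-1}+1},\dots,s_{\lambda_1+\dots+\lambda_i-1}$ (trivial if $\lambda_i=1$). $\lambda-1$ denotes the composition obtained from $\lambda$ by replacing each $\lambda_i>1$ by the two consecutive entries $\lambda_i-1,1$. The element $w_\lambda\in S_\lambda$ is the product over $i=1,\dots,r$ of $s_{\lambda_1+\dots+\lambda_{i-1}+1}\cdots s_{\lambda_1+\dots+\lambda_i-1}$ (in increasing order of indices; empty product if $\lambda_i=1$), and $l_\lambda=\ell(w_\lambda)$. For standard parabolic subgroups $S_\mu\le S_\lambda$ and $h\in\mathcal H$, the relative norm is $\mathcal N_{S_\lambda,S_\mu}(h)=\sum_{d}\tilde T_{d^{-1}}h\tilde T_d$, the sum over the distinguished (minimal length) representatives $d$ of the right cosets $S_\mu d$ of $S_\mu$ in $S_\lambda$. Put $\eta_\lambda=\mathcal N_{S_{\lambda-1},1}(\tilde T_{w_\lambda})$ and $b_\alpha=\mathcal N_{S_n,S_\alpha}(\eta_\alpha)$; then $b_\alpha\in Z(\mathcal H)$. For $\lambda\vdash n$ let $C_\lambda$ be the conjugacy class of $S_n$ of cycle type $\lambda$. The class elements $\{\Gamma_\lambda\mid\lambda\vdash n\}$ are the elements of $Z(\mathcal H)$ characterized (Geck--Rouquier) by: $\Gamma_\lambda|_{\xi=0}=\sum_{w\in C_\lambda}w$, and in $\Gamma_\lambda-\sum_{w\in C_\lambda}\tilde T_w$ the coefficient of $\tilde T_w$ is zero whenever $w$ has minimal length in its conjugacy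 class. They form a $\mathbb Z[\xi]$-basis of $Z(\mathcal H)$. *)

(* Defs.v *)
(* Mathematical Components *)
From HB Require Import structures.
From mathcomp Require Import all_boot all_order all_fingroup all_algebra.

Set Implicit Arguments.
Unset Strict Implicit.
Unset Printing Implicit Defensive.

Import GRing.Theory.

Section SymmetricGroup.

Variable n : nat.

Lemma simple_ltS (i : 'I_n.-1) : i.+1 < n.
Proof. by rewrite -ltn_predRL. Qed.

Lemma simple_lt (i : 'I_n.-1) : i < n.
Proof. exact: ltnW (simple_ltS i). Qed.

(* Indices are shifted by one: simple_refl i is s_(i+1) = (i+1  i+2) in the
   numbering of {1, ..., n}. *)
Definition simple_refl (i : 'I_n.-1) : 'S_n :=
  tperm (Ordinal (simple_lt i)) (Ordinal (simple_ltS i)).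

Definition word_perm (s : seq 'I_n.-1) : 'S_n :=
  (\prod_(i <- s) simple_refl i)%g.

Lemma word_perm_cat s t : word_perm (s ++ t) = (word_perm s * word_perm t)%g.
Proof. by rewrite /word_perm big_cat. Qed.

Lemma tperm_word (k : nat) (x y : 'I_n) :
  x + k.+1 = y -> exists s, word_perm s = tperm x y.
Proof.
elim: k y => [|k IHk] y xy.
  have lt_x : x < n.-1 by rewrite ltn_predRL -[X in (X < _)%N]addn1 xy.
  exists [:: Ordinal lt_x]; rewrite /word_perm big_seq1 /simple_refl.
  by congr (tperm _ _); apply: val_inj => //=; rewrite -xy addn1.
have lt_z : x + k.+1 < n.-1.
  by rewrite ltn_predRL -addnS xy.
pose j := Ordinal lt_z; pose z := Ordinal (simple_lt j).
have [s sE] := IHk z erefl.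
exists (j :: s ++ [:: j]).
have -> : word_perm (j :: s ++ [:: j]) = (tperm x z ^ simple_refl j)%g.
  rewrite -cat1s !word_perm_cat sE {1 2}/word_perm !big_seq1.
  by rewrite /conjg {2}/simple_refl tpermV mulgA.
have yE : y = Ordinal (simple_ltS j) by apply: val_inj; rewrite /= -xy addnS.
rewrite tpermJ /simple_refl -/z tpermL -yE tpermD //.
  by apply/eqP => /(congr1 val) /= /eqP; rewrite -[X in _ == X]addn0 eqn_add2l.
apply/eqP => /(congr1 val) /= /eqP.
by rewrite -xy -[X in _ == X]addn0 eqn_add2l.
Qed.

Lemma word_perm_surj (w : 'S_n) : exists s, word_perm s = w.
Proof.
have [ts -> _] := prod_tpermP w.
elim: ts => [|[x y] ts [s sE]]; 
  first by exists [::]; rewrite /word_perm !big_nil.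
have [t tE] : exists t, word_perm t = tperm x y.
  have [lt_xy|lt_yx|/val_inj->] := ltngtP x y.
  - by apply: (@tperm_word (y - x.+1)); rewrite -subSn // subSS subnKC // ltnW.
  - rewrite tpermC.
    by apply: (@tperm_word (x - y.+1)); rewrite -subSn // subSS subnKC // ltnW.
  - by exists [::]; rewrite tperm1 /word_perm big_nil.
by exists (t ++ s); rewrite word_perm_cat big_cons /= tE sE.
Qed.

Lemma word_tuple_surj (w : 'S_n) :
  exists k, [exists t : k.-tuple 'I_n.-1, word_perm t == w].
Proof.
have [s sE] := word_perm_surj w; exists (size s).
by apply/existsP; exists (in_tuple s); rewrite sE.
Qed.

Definition coxlen (w : 'S_n) : nat := ex_minn (word_tuple_surj w).

Lemma coxlen_word (w : 'S_n) :
  exists t : (coxlen w).-tuple 'I_n.-1, word_perm t == w.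
Proof. by rewrite /coxlen; case: ex_minnP => k /existsP. Qed.

(* A chosen reduced expression of w. *)
Definition reduced_word (w : 'S_n) : seq 'I_n.-1 := xchoose (coxlen_word w).

Lemma reduced_wordP (w : 'S_n) :
  word_perm (reduced_word w) = w /\ size (reduced_word w) = coxlen w.
Proof.
by split; [apply/eqP/(xchooseP (coxlen_word w)) | rewrite size_tuple].
Qed.

Lemma coxlen_min (s : seq 'I_n.-1) : coxlen (word_perm s) <= size s.
Proof.
rewrite /coxlen; case: ex_minnP => k _; apply.
by apply/existsP; exists (in_tuple s).
Qed.

Definition min_in_class (w : 'S_n) : bool :=
  [forall v in (w ^: [set: 'S_n])%g, coxlen w <= coxlen v].

Definition cycle_type (w : 'S_n) : seq nat :=
  sort geq [seq #|(c : {set 'I_n})| | c <- enum (porbits w)].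

Definition type_class (la : seq nat) : {set 'S_n} :=
  [set w | cycle_type w == la].

(* Positions (in the indexing of simple_refl) of the simple reflections of
   the factors of S_la, where the first factor starts at position off. *)
Fixpoint block_positions (off : nat) (la : seq nat) : seq nat :=
  if la is l :: la' then iota off l.-1 ++ block_positions (off + l) la'
  else [::].

(* When la is a composition of n all these positions are < n.-1, so pmap
   discards nothing. *)
Definition parabolic_gens (la : seq nat) : seq 'I_n.-1 :=
  pmap insub (block_positions 0 la).

Definition parabolic (la : seq nat) : {set 'S_n} :=
  <<[set simple_refl i | i in parabolic_gens la]>>%g.

Definition parabolic_cox (la : seq nat) : 'S_n := word_perm (parabolic_gens la).

(* Minimal length representatives d in G of the right cosets K d. *)
Definition dist_reps (G K : {set 'S_n}) : {set 'S_n} :=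
  [set d in G | [forall v in (K :* d)%g, coxlen d <= coxlen v]].

End SymmetricGroup.

(* The composition written la - 1. *)
Definition comp_pred (la : seq nat) : seq nat :=
  flatten [seq if 1 < l then [:: l.-1; 1] else [:: l] | l <- la].

Definition is_partition (n : nat) (la : seq nat) : bool :=
  [&& sorted geq la, all (ltn 0) la & sumn la == n].

Record intpart (n : nat) : Type :=
  IntPart { parts :> seq nat; _ : is_partition n parts }.

HB.instance Definition _ n := [isSub for @parts n].
HB.instance Definition _ n := [Countable of intpart n by <:].

Section IntPartFinite.

Variable n : nat.

Lemma partition_bound (la : seq nat) : all (ltn 0) la ->
  size la <= sumn la /\ all (geq (sumn la)) la.
Proof.
elim: la => //= l la IHla /andP[l_gt0 /IHla[le_size le_la]]; split.
  by rewrite -add1n leq_add.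
rewrite leq_addr /=; apply: sub_all le_la => x /= le_x.
exact: leq_trans le_x (leq_addl _ _).
Qed.

Definition intpart_bseq (p : intpart n) : n.-bseq 'I_n.+1 :=
  insub_bseq n [seq inord l | l <- p].

Definition bseq_intpart (b : n.-bseq 'I_n.+1) : option (intpart n) :=
  insub [seq val i | i <- b].

Lemma intpart_bseqK : pcancel intpart_bseq bseq_intpart.
Proof.
case=> la la_part; have /and3P[_ la_gt0 /eqP la_n] := la_part.
have [] := partition_bound la_gt0; rewrite la_n => le_size le_la.
rewrite /bseq_intpart /intpart_bseq /insub_bseq insubdK /=.
  have -> : [seq val i | i <- [seq (inord l : 'I_n.+1) | l <- la]] = la.
    rewrite -map_comp -[RHS]map_id; apply/eq_in_map => l /(allP le_la) /= le_l.
    by rewrite inordK.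
  by rewrite insubT.
by rewrite unfold_in size_map.
Qed.

Lemma row_part_proof : 0 < n -> is_partition n [:: n].
Proof. by move=> n_gt0; rewrite /is_partition /= n_gt0 addn0 eqxx. Qed.

(* The partition (n). *)
Definition row_part (n_gt0 : 0 < n) : intpart n :=
  IntPart (row_part_proof n_gt0).

End IntPartFinite.

HB.instance Definition _ n : isFinite (intpart n) :=
  PCanIsFinite (@intpart_bseqK n).

Local Open Scope ring_scope.

(* The indeterminate xi of Z[xi] is 'X : {poly int}. *)
Definition hecke_relations (n : nat) (A : algType {poly int})
    (g : 'I_n.-1 -> A) : Prop :=
  [/\ forall i j : 'I_n.-1, (i.+1 < j)%N -> g i * g j = g j * g i,
      forall i j : 'I_n.-1, j = i.+1 :> nat ->
        g i * g j * g i = g j * g i * g j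
    & forall i : 'I_n.-1, g i * g i = 1 + 'X *: g i].

(* H, with the generators g, is the Z[xi]-algebra presented by
   hecke_relations: the relations hold and H is universal for them. *)
Definition is_hecke (n : nat) (H : algType {poly int})
    (g : 'I_n.-1 -> H) : Prop :=
  [/\ hecke_relations g,
      forall (A : algType {poly int}) (a : 'I_n.-1 -> A), hecke_relations a ->
        exists f : {lrmorphism H -> A}, forall i, f (g i) = a i
    & forall (A : algType {poly int}) (f1 f2 : {lrmorphism H -> A}),
        (forall i, f1 (g i) = f2 (g i)) -> f1 =1 f2].

Section Hecke.

Variables (n : nat) (H : algType {poly int}) (g : 'I_n.-1 -> H).

(* By the braid relations the product does not depend on the reduced
   expression. *)
Definition hecke_T (w : 'S_n) : H := \prod_(i <- reduced_word w) g i.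

Definition rel_norm (G K : {set 'S_n}) (h : H) : H :=
  \sum_(d in dist_reps G K) hecke_T d^-1%g * h * hecke_T d.

Definition eta (la : seq nat) : H :=
  rel_norm (parabolic n (comp_pred la)) 1%g (hecke_T (parabolic_cox n la)).

Definition b_elt (la : seq nat) : H :=
  rel_norm [set: 'S_n] (parabolic n la) (eta la).

(* The second clause is the specialization z|_(xi = 0): the coefficients of
   z on the T_w, evaluated at 0, are those of the class sum in Z S_n. *)
Definition is_class_element (la : seq nat) (z : H) : Prop :=
  [/\ forall h, z * h = h * z,
      exists2 p : 'S_n -> {poly int},
        z = \sum_w p w *: hecke_T w
        & forall w, (p w).[0] = (w \in type_class n la)%:R
    & exists2 q : 'S_n -> {poly int},
        z - \sum_(w in type_class n la) hecke_T w = \sum_w q w *: hecke_T w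
        & forall w, min_in_class w -> q w = 0].

End Hecke.

(* Main.v *)
Require Import Defs.
From HB Require Import structures.
From mathcomp Require Import all_boot all_order all_fingroup all_algebra.
From mathcomp Require Import zify ring.

(* Let c = s_1 ... s_(n-1).  It has minimal length in its class, the n-cycles,
   so the coefficient of Gamma_(n) in a combination of class elements is its
   coefficient on T_c, which is read off the regular representation.  In the
   sum defining b_alpha the representatives d of S_n and e of S_(alpha-1)
   combine to x = e d with additive lengths, and since left and right
   multiplications commute, the coefficient of T_c in T_(x^-1) T_w T_x, with
   w = w_alpha, is the coefficient of T_(w x) in T_x T_c.  Expanding
   T_x T_(s_1) ... T_(s_(n-1)), this counts, with weight a power of xi, the
   subwords t of s_1 ... s_(n-1) with x t = w x whose omitted letters are
   descents.  Conjugation by x maps the cycles of t, which are intervals, to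
   the blocks of alpha, and the descent condition forces these intervals to
   carry the blocks in reverse order.  As e fixes the last point of each block
   and d is increasing on blocks, this leaves exactly one pair (x, t), in which
   t has l_alpha letters and n - 1 - l_alpha letters are omitted. *)

Set Implicit Arguments.
Unset Strict Implicit.
Unset Printing Implicit Defensive.

Import GRing.Theory.

(** * Inversions and blocks of consecutive positions *)

Section Inversions.

Variable n : nat.
Implicit Types (i j : 'I_n.-1) (u v : 'I_n) (w x d e : 'S_n).
Implicit Types (s t J : seq 'I_n.-1).

Definition lo i : 'I_n := Ordinal (simple_lt i).
Definition hi i : 'I_n := Ordinal (simple_ltS i).

Lemma lo_inj : injective lo.
Proof. by move=> i j /(congr1 val) /= /val_inj. Qed.

Lemma lo_neq_hi i : lo i != hi i.
Proof. by rewrite -val_eqE /=; lia. Qed.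

Lemma lo_ex v v' : v < v' -> exists i, lo i = v.
Proof.
move=> lt_v; have lt_v1 : v < n.-1 by have := ltn_ord v'; lia.
by exists (Ordinal lt_v1); apply: val_inj.
Qed.

Lemma refl_lo i : simple_refl i (lo i) = hi i.
Proof. exact: tpermL. Qed.

Lemma refl_hi i : simple_refl i (hi i) = lo i.
Proof. exact: tpermR. Qed.

Lemma refl_id i v : v != lo i -> v != hi i -> simple_refl i v = v.
Proof. by move=> vl vh; rewrite /simple_refl tpermD // eq_sym. Qed.

Lemma refl_sqr i : (simple_refl i * simple_refl i = 1)%g.
Proof. exact: tperm2. Qed.

Lemma reflV i : (simple_refl i)^-1%g = simple_refl i.
Proof. exact: tpermV. Qed.

Lemma reflK i : involutive (simple_refl i).
Proof. exact: tpermK. Qed.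

Lemma word_perm_cons i s :
  word_perm (i :: s) = (simple_refl i * word_perm s)%g.
Proof. exact: big_cons. Qed.

Lemma word_perm_nil : word_perm [::] = 1%g :> 'S_n.
Proof. exact: big_nil. Qed.

Lemma word_perm_rev s : word_perm (rev s) = (word_perm s)^-1%g.
Proof.
elim: s => [|i s IHs]; first by rewrite word_perm_nil invg1.
rewrite rev_cons -cats1 word_perm_cat IHs !word_perm_cons word_perm_nil mulg1.
by rewrite invMg reflV.
Qed.

Lemma refl_lt i u v : (u, v) != (lo i, hi i) -> (u, v) != (hi i, lo i) ->
  (simple_refl i u < simple_refl i v) = (u < v).
Proof.
rewrite !xpair_eqE /simple_refl -!val_eqE /=.
case: (tpermP _ _ u) => [->|->|/eqP+ /eqP+];
  case: (tpermP _ _ v) => [->|->|/eqP+ /eqP+]; rewrite -?val_eqE /=; lia.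
Qed.

Definition inv_num w : nat :=
  \sum_(p : 'I_n * 'I_n) ((p.1 < p.2) && (w p.2 < w p.1)).

Lemma inv_num1 : inv_num 1 = 0.
Proof.
by apply: big1 => -[u v] _ /=; rewrite !perm1; case: ltngtP.
Qed.

Lemma inv_numV w : inv_num w^-1%g = inv_num w.
Proof.
rewrite /inv_num (reindex_inj (h := fun p => (w p.2, w p.1))) /=.
  by apply: eq_bigr => -[u v] _ /=; rewrite !permK andbC.
by move=> [u v] [u' v'] /= [/perm_inj-> /perm_inj->].
Qed.

(** Apply [simple_refl i] to both entries of every pair: by [refl_lt] only the terms of
    [(lo i, hi i)] and [(hi i, lo i)] change. The boolean summands express a change by one without
    subtraction in [nat]. *)
Lemma inv_num_mull i w :
  inv_num (simple_refl i * w) + (w (hi i) < w (lo i)) =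
  inv_num w + (w (lo i) < w (hi i)).
Proof.
have lh := lo_neq_hi i.
have neq : (hi i, lo i) != (lo i, hi i) by rewrite xpair_eqE eq_sym negb_and lh.
rewrite {1}/inv_num.
rewrite (reindex_inj (h := fun p => (simple_refl i p.1, simple_refl i p.2))) /=.
  rewrite (bigD1 (lo i, hi i)) //= (bigD1 (hi i, lo i)) //=.
  rewrite [in RHS]/inv_num [in RHS](bigD1 (lo i, hi i)) //=.
  rewrite [in RHS](bigD1 (hi i, lo i)) //=.
  rewrite !permM !reflK !refl_lo !refl_hi /= ltnSn ltnNge leqnSn /= add0n.
  set rest := bigop _ _ _; set rest' := bigop _ _ _.
  suff -> : rest = rest' by do 2![case: (w _ < w _)]; lia.
  by apply: eq_bigr => -[u v] /andP[Ne1 Ne2] /=; rewrite !permM !reflK refl_lt.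
by move=> [u v] [u' v'] /= [/perm_inj-> /perm_inj->].
Qed.

Lemma perm_ltN w u v : u != v -> (w u < w v) = ~~ (w v < w u).
Proof.
move=> neq_uv; rewrite -leqNgt [RHS]leq_eqVlt val_eqE (inj_eq perm_inj).
by rewrite (negPf neq_uv).
Qed.

(** Right descents: a product applies its left factor first, so [w * simple_refl i] exchanges the
    values [lo i] and [hi i] of [w], and by [inv_num_mulr] it is shorter exactly in this case. *)
Definition desc w i : bool := w^-1%g (hi i) < w^-1%g (lo i).

Lemma descNE w i : ~~ desc w i = (w^-1%g (lo i) < w^-1%g (hi i)).
Proof.
by rewrite /desc -perm_ltN ?lo_neq_hi.
Qed.

Lemma inv_num_mulr w i :
  inv_num (w * simple_refl i) + desc w i = inv_num w + ~~ desc w i.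
Proof.
by rewrite -inv_numV invMg reflV inv_num_mull inv_numV descNE.
Qed.

Lemma inv_num_word_le w s : inv_num (w * word_perm s) <= inv_num w + size s.
Proof.
elim: s w => [|i s IHs] w; first by rewrite word_perm_nil mulg1 addn0.
rewrite word_perm_cons mulgA (leq_trans (IHs _)) //=.
have := inv_num_mulr w i; set a := inv_num (w * _); case: desc; lia.
Qed.

Lemma ord_chain (r : rel 'I_n) u v : reflexive r -> transitive r -> u <= v ->
  (forall i, u <= i < v -> r (lo i) (hi i)) -> r u v.
Proof.
move=> r_refl r_trans; move Dk: (v - u) => k.
elim: k v Dk => [|k IHk] v Dk le_uv Hr.
  by have -> : u = v by apply: val_inj; rewrite /=; lia.
have lt_v : v.-1 < n.-1 by have := ltn_ord v; lia.
pose i := Ordinal lt_v.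
have -> : v = hi i by apply: val_inj; rewrite /=; lia.
apply: (r_trans (lo i)); last by apply: Hr; rewrite /=; lia.
apply: IHk => /=; [lia | lia |] => j /= lt_j.
by apply: Hr; lia.
Qed.

Lemma increasing_perm1 w : (forall i, w (lo i) < w (hi i)) -> w = 1%g.
Proof.
move=> w_inc.
have w_mono u v : u <= v -> w u <= w v.
  move=> le_uv.
  apply: (@ord_chain (fun u v => w u <= w v)) => //.
  - by move=> b a c; apply: leq_trans.
  - by move=> i _; apply: ltnW.
(* A monotone permutation moves no point down, by induction on the point. This is used for [w] and
   for its inverse. *)
have ge_id (x : 'S_n) : (forall u v, u <= v -> x u <= x v) -> forall v, v <= x v.
  move=> x_mono v; move Dk: (nat_of_ord v) => k; elim: k v Dk => // k IHk v Dk.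
  have lt_k : k < n by have := ltn_ord v; lia.
  have := IHk (Ordinal lt_k) erefl.
  move=> /leq_ltn_trans; apply.
  rewrite ltn_neqAle x_mono /=; last by rewrite Dk.
  by rewrite andbT val_eqE (inj_eq perm_inj) -val_eqE /= Dk; lia.
apply/permP => v; rewrite perm1; apply/val_inj/eqP.
rewrite eqn_leq ge_id // andbT -{2}(permK w v) ge_id // => u u' le_u.
rewrite leqNgt; apply/negP => lt_u.
have := w_mono _ _ (ltnW lt_u); rewrite !permKV => le_u'.
have E : u = u' by apply: val_inj; apply/eqP; rewrite eqn_leq le_u le_u'.
by rewrite E ltnn in lt_u.
Qed.

(** One letter changes the number of inversions by one, so a word has at least that many letters.
    Conversely, a permutation other than 1 has an inversion at neighbouring positions, which a
    letter on the left removes. *)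
Lemma coxlen_inv_num w : coxlen w = inv_num w.
Proof.
apply/eqP; rewrite eqn_leq; apply/andP; split; last first.
  have [sE <-] := reduced_wordP w.
  by have := inv_num_word_le 1 (reduced_word w); rewrite mul1g inv_num1 sE.
suff: exists2 s, word_perm s = w & size s <= inv_num w.
  by case=> s <- /(leq_trans (coxlen_min s)).
move Dk: (inv_num w) => k; elim: k w Dk => [|k IHk] w Dk.
  exists [::]; rewrite // word_perm_nil; apply/esym/increasing_perm1 => i.
  have := inv_num_mull i w; rewrite Dk.
  have : w (lo i) != w (hi i) by rewrite (inj_eq perm_inj) lo_neq_hi.
  by rewrite -val_eqE /=; lia.
have [i desc_i] : exists i, w (hi i) < w (lo i).
  case: (pickP [pred i | w (hi i) < w (lo i)]) => [i /= ?|asc]; first by exists i.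
  suff w1 : w = 1%g by rewrite w1 inv_num1 in Dk.
  apply: increasing_perm1 => i; have /negbT := asc i; rewrite /=.
  rewrite -leqNgt leq_eqVlt val_eqE (inj_eq perm_inj).
  by rewrite (negPf (lo_neq_hi i)).
have Dk' : inv_num (simple_refl i * w)%g = k.
  by have := inv_num_mull i w; rewrite Dk; lia.
have [s sE le_s] := IHk _ Dk'.
by exists (i :: s); rewrite //= word_perm_cons sE mulgA refl_sqr mul1g.
Qed.

Lemma inv_num_eq0 w : inv_num w = 0 -> w = 1%g.
Proof.
rewrite -coxlen_inv_num; have [sE <-] := reduced_wordP w.
by move/size0nil=> s0; rewrite -sE s0 word_perm_nil.
Qed.

(** Used for block numbers and for the tests [v <= j]: a word without the letter [j] moves no point
    across the gap between [lo j] and [hi j]. *)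
Lemma word_perm_invariant (T : eqType) (f : 'I_n -> T) s :
  (forall i, i \in s -> f (lo i) = f (hi i)) ->
  forall v, f (word_perm s v) = f v.
Proof.
elim: s => [|i s IHs] f_s v; first by rewrite word_perm_nil perm1.
rewrite word_perm_cons permM IHs => [|j sj]; last by rewrite f_s // inE sj orbT.
have fi := f_s i (mem_head _ _).
have [->|vl] := eqVneq v (lo i); first by rewrite refl_lo.
have [->|vh] := eqVneq v (hi i); first by rewrite refl_hi.
by rewrite refl_id.
Qed.

Lemma word_perm_invariantV (T : eqType) (f : 'I_n -> T) s :
  (forall i, i \in s -> f (lo i) = f (hi i)) ->
  forall v, f ((word_perm s)^-1%g v) = f v.
Proof.
by move=> f_s v; rewrite -{2}(permKV (word_perm s) v) word_perm_invariant.
Qed.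

Definition sortedw s := sorted ltn (map val s).

Lemma sortedw_cons i s : sortedw (i :: s) ->
  sortedw s /\ forall j, j \in s -> i < j.
Proof.
rewrite /sortedw /= => pth; split; first exact: path_sorted pth.
move=> j sj; have /allP := order_path_min ltn_trans pth.
by apply; apply: map_f.
Qed.

Lemma sortedw_uniq s : sortedw s -> uniq s.
Proof. by move=> /(sorted_uniq ltn_trans ltnn) /map_uniq. Qed.

Lemma enum_sortedw : sortedw (enum 'I_n.-1).
Proof. by rewrite /sortedw val_enum_ord iota_ltn_sorted. Qed.

Lemma sortedw_subseq s t : subseq s t -> sortedw t -> sortedw s.
Proof.
move=> /(map_subseq val) st; apply: subseq_sorted st => // *.
by apply: ltn_trans; eassumption.
Qed.

(** The letters before [i] are too small to touch [hi i], then [i] sends it to [lo i], and the later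
    letters are too large to touch [lo i]. *)
Lemma sortedw_hi s i : sortedw s -> i \in s -> word_perm s (hi i) = lo i.
Proof.
elim: s => // j s IHs /sortedw_cons[s_sorted lt_j]; rewrite inE.
rewrite word_perm_cons permM => /orP[/eqP->|si].
  rewrite refl_hi.
  have := @word_perm_invariant _ (pred1 (lo j)) s.
  move=> /(_ _ (lo j)) /= H; apply/eqP; rewrite H ?eqxx // => k /lt_j lt_k.
  by rewrite -!val_eqE /=; lia.
by rewrite refl_id ?IHs //; rewrite -val_eqE /=; have := lt_j _ si; lia.
Qed.

(** A first letter [i] below all others adds an inversion: the other letters neither lift [lo i]
    above [i] nor bring [hi i] down to [i]. *)
Lemma sortedw_inv_num s : sortedw s -> inv_num (word_perm s) = size s.
Proof.
elim: s => [|i s IHs]; first by rewrite word_perm_nil inv_num1.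
case/sortedw_cons => s_sorted lt_i; rewrite word_perm_cons /= -IHs //.
have Hl : word_perm s (lo i) <= i.
  have := @word_perm_invariant _ (fun v : 'I_n => v <= i) s.
  by move=> ->; rewrite /= ?leqnn // => k /lt_i lt_k /=; lia.
have Hh : (word_perm s (hi i) <= i) = (hi i <= i).
  by apply: (@word_perm_invariant _ (fun v : 'I_n => v <= i)) => k /lt_i /=; lia.
have := inv_num_mull i (word_perm s).
move: Hh; rewrite /=; lia.
Qed.

(** The number, from 0, of the block containing [v]: a letter of [J] joins [lo j] to [hi j], and
    each letter outside [J] is a gap between two blocks. *)
Definition blk J v : nat := #|[pred j : 'I_n.-1 | (j < v) && (j \notin J)]|.

Lemma blk_mono J u v : u <= v -> blk J u <= blk J v.
Proof.
move=> le_uv; apply/subset_leq_card/subsetP => j; rewrite !inE.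
by case/andP=> lt_j ->; rewrite (leq_trans lt_j).
Qed.

Lemma blk_lt J u v i : u <= i < v -> i \notin J -> blk J u < blk J v.
Proof.
case/andP=> le_i lt_i iJ; apply/proper_card/properP; split.
  apply/subsetP => j; rewrite !inE; case/andP=> lt_j ->.
  by rewrite andbT; lia.
by exists i; rewrite !inE iJ ?lt_i // andbT; lia.
Qed.

Lemma blk_lt_mono J u v : blk J u < blk J v -> u < v.
Proof. by rewrite ltnNge; apply: contraR; rewrite -leqNgt; apply: blk_mono. Qed.

Lemma blk_adj J i : i \in J -> blk J (lo i) = blk J (hi i).
Proof.
move=> iJ; apply: eq_card => j; rewrite !inE /= ltnS.
by case: ltngtP => // /ord_inj->; rewrite iJ.
Qed.

Lemma blk_mem J u v i : blk J u = blk J v -> u <= i < v -> i \in J.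
Proof.
by move=> E lt_i; apply/negPn/negP => /(blk_lt lt_i); rewrite E ltnn.
Qed.

Lemma blk_chain J (r : rel 'I_n) u v : reflexive r -> transitive r ->
  blk J u = blk J v -> u <= v -> (forall i, i \in J -> r (lo i) (hi i)) -> r u v.
Proof.
move=> r_refl r_trans E le_uv Hr; apply: ord_chain => // i lt_i.
exact/Hr/blk_mem/lt_i.
Qed.

(** [preserves] describes the parabolic subgroup of [J] by its action on blocks; [increasing]
    describes the distinguished representatives of its right cosets. *)
Definition preserves J w := forall v, blk J (w v) = blk J v.
Definition increasing J w := forall i, i \in J -> w (lo i) < w (hi i).

Lemma increasing_mono J d u v : increasing J d -> blk J u = blk J v ->
  (d u < d v) = (u < v).
Proof.
move=> d_inc; wlog le_uv : u v / u <= v => [IH|] E.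
  have [/IH->//|/ltnW le_vu] := leqP u v.
  have := IH _ _ le_vu (esym E) => H.
  have [->|neq] := eqVneq u v; first by rewrite !ltnn.
  have neq' : d u != d v by rewrite (inj_eq perm_inj).
  by move: H neq neq'; rewrite -!val_eqE /=; case: (ltngtP (d u) (d v)); case: (ltngtP u v).
have le_d : d u <= d v.
  apply: (@blk_chain J (fun u v => d u <= d v)) => //.
  - by move=> b a c; apply: leq_trans.
  - by move=> i /d_inc/ltnW.
rewrite !ltn_neqAle le_uv le_d !andbT; congr negb.
by rewrite !val_eqE (inj_eq perm_inj).
Qed.

(* Each inversion of [e * d] is an inversion of [e] when both entries lie in
   the same block, and is carried by [e] to an inversion of [d] otherwise. *)
Lemma inv_num_mul J e d : preserves J e -> increasing J d ->
  inv_num (e * d) = inv_num e + inv_num d.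
Proof.
move=> eJ d_inc; rewrite {3}/inv_num.
rewrite (reindex_inj (h := fun p => (e p.1, e p.2))) /=; last first.
  by move=> [u v] [u' v'] /= [/perm_inj-> /perm_inj->].
rewrite -big_split; apply: eq_bigr => -[u v] _ /=; rewrite !permM.
have [E|neq] := eqVneq (blk J u) (blk J v).
  have E' : blk J (e u) = blk J (e v) by rewrite !eJ.
  rewrite (increasing_mono d_inc (esym E')).
  by case: (ltngtP (e u) (e v)) => //=; rewrite ?andbF ?addn0.
have ltE a b : blk J a != blk J b -> (a < b) = (blk J a < blk J b).
  move=> ne; apply/idP/idP; last exact: blk_lt_mono.
  by move=> /ltnW/(blk_mono J); rewrite ltn_neqAle ne.
rewrite (ltE u v) // (ltE (e u) (e v)) ?eJ // (ltE (e v) (e u)) ?eJ; last by rewrite eq_sym.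
by case: (ltngtP (blk J u) (blk J v)) neq.
Qed.

Lemma preserves1 J : preserves J 1%g.
Proof. by move=> v; rewrite perm1. Qed.

Lemma preservesV J w : preserves J w -> preserves J w^-1%g.
Proof. by move=> wJ v; rewrite -{2}(permKV w v) wJ. Qed.

Lemma preservesM J w x : preserves J w -> preserves J x -> preserves J (w * x)%g.
Proof. by move=> wJ xJ v; rewrite permM xJ wJ. Qed.

Lemma preserves_word J s : {subset s <= J} -> preserves J (word_perm s).
Proof. by move=> sJ v; apply: word_perm_invariant => i /sJ /blk_adj. Qed.

(** The first hypothesis says that [v] is the last point of its block, a form used again below. A
    later point of the block would force the letter at position [v] into [J]. *)
Lemma blk_last J u v : (forall i, i \in J -> lo i != v) ->
  blk J u = blk J v -> u <= v.
Proof.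
move=> v_last E; rewrite leqNgt; apply/negP => lt_vu.
have [i iv] := lo_ex lt_vu.
have /v_last/eqP[] // : i \in J.
have iE : i = v :> nat by rewrite -iv.
by apply: (blk_mem (esym E)); rewrite iE leqnn.
Qed.

(** What remains are the first points of blocks. Their images cannot be any [lo i], which is already
    the image of [hi i], so both permutations send them to the last point of the same block. *)
Lemma preserves_hi_uniq J w x : preserves J w -> preserves J x ->
  (forall i, i \in J -> w (hi i) = lo i) ->
  (forall i, i \in J -> x (hi i) = lo i) -> w = x.
Proof.
move=> wJ xJ w_hi x_hi; apply/permP => v.
have [/existsP[i /andP[iJ /eqP <-]]|] := boolP [exists i, (i \in J) && (hi i == v)].
  by rewrite w_hi ?x_hi.
rewrite negb_exists => /forallP v_first.
have last (y : 'S_n) : (forall i, i \in J -> y (hi i) = lo i) ->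
    forall i, i \in J -> lo i != y v.
  move=> y_hi i iJ; apply/eqP => E; have := v_first i.
  by rewrite iJ /= -(inj_eq (@perm_inj _ y)) y_hi // E eqxx.
apply/val_inj/eqP; rewrite eqn_leq.
by rewrite !(@blk_last J) ?wJ ?xJ //; apply: last.
Qed.

End Inversions.

(** * Walks from x to w x *)

Section Walks.

Variable n : nat.
Implicit Types (i j : 'I_n.-1) (u v z : 'I_n) (w x d e : 'S_n).
Implicit Types (s t p J : seq 'I_n.-1).

Lemma blk_const J (T : eqType) (f : 'I_n -> T) u v :
  (forall i, i \in J -> f (lo i) = f (hi i)) -> blk J u = blk J v -> f u = f v.
Proof.
move=> fJ E; wlog le_uv : u v E / u <= v => [IH|].
  have [/(IH _ _ E)->//|/ltnW /(IH _ _ (esym E))] := leqP u v; exact: esym.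
apply/eqP; apply: (@blk_chain _ J (fun u v => f u == f v)) => //.
- by move=> b a c /eqP->.
- by move=> i /fJ->.
Qed.

(* The subwords of [s] along which multiplying [x] by the letters of [s] one
   after the other may proceed, a letter being omitted only at a descent. *)
Fixpoint walks x s : seq (seq 'I_n.-1) :=
  if s is i :: s' then
    [seq i :: t | t <- walks (x * simple_refl i)%g s'] ++
    (if desc x i then walks x s' else [::])
  else [:: [::]].

Lemma walks_subseq x s t : t \in walks x s -> subseq t s.
Proof.
elim: s x t => [|i s IHs] x t /=.
  by rewrite inE => /eqP->.
rewrite mem_cat => /orP[/mapP[t' /IHs t's ->]|]; first by rewrite eqxx.
case: ifP => // _ /IHs ts; exact: subseq_trans ts (subseq_cons _ _).
Qed.

Lemma walks_uniq x s : uniq s -> uniq (walks x s).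
Proof.
elim: s x => //= i s IHs x /andP[iNs s_uniq].
rewrite cat_uniq map_inj_uniq ?IHs //=; last by move=> t t' [].
rewrite [X in _ && X](_ : _ = true) ?andbT; last by case: ifP => // _; apply: IHs.
apply/hasPn => t; case: ifP => // _ /walks_subseq/mem_subseq ts.
apply/negP => /mapP[t' _ E]; move: iNs; rewrite ts //.
by rewrite E mem_head.
Qed.

(** Here [p] is made of the letters kept before [i]. Only its inclusion in [t] is recorded, since
    block numbers will be invariant under all letters of [t]. *)
Lemma walks_stay x s t i : t \in walks x s -> i \in s -> i \notin t ->
  exists2 p, {subset p <= t} & desc (x * word_perm p) i.
Proof.
elim: s x t => // j s IHs x t /=.
rewrite mem_cat => /orP[/mapP[t' t's ->]|].
  rewrite !inE negb_or => /orP[->//|si] /andP[_ it'].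
  have [p pt' di] := IHs _ _ t's si it'.
  exists (j :: p); last by rewrite word_perm_cons mulgA.
  by move=> k; rewrite !inE => /orP[->//|/pt'->]; rewrite orbT.
case: ifP => // dj ts; rewrite inE => /orP[/eqP->|si] it; last exact: IHs it.
by exists [::]; rewrite // word_perm_nil mulg1.
Qed.

Lemma walks_filter x s t :
  (forall i p, i \notin t -> {subset p <= t} -> desc (x * word_perm p) i) ->
  [seq i <- s | i \in t] \in walks x s.
Proof.
elim: s x => //= i s IHs x dt; rewrite mem_cat; case: ifPn => it.
  rewrite map_f // IHs // => j p jt pt; rewrite -mulgA -word_perm_cons dt //.
  by move=> k; rewrite inE => /orP[/eqP->//|/pt].
by have := dt i [::] it; rewrite word_perm_nil mulg1 => ->; rewrite // IHs ?orbT.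
Qed.

(** The number of the block of [J] from which [x] carries a point to position [u]. *)
Definition beta J x u := blk J (x^-1%g u).

(** With [J] the letters of [w_alpha], the last clause says that the walk leads from [x] to
    [w_alpha x]; equivalently, [x] conjugates [w_alpha] into the product of [t]. *)
Definition closed_walk J x t :=
  [/\ sortedw t,
      forall i, i \notin t -> exists2 p, {subset p <= t} & desc (x * word_perm p) i
    & (x * word_perm t = word_perm J * x)%g].

(** [x] takes its largest value on a block at the last point. The products [e * d] in the norm have
    this property, and it singles out one [x]. *)
Definition block_max J x := forall v z,
  (forall i, i \in J -> lo i != v) -> blk J z = blk J v -> x z <= x v.

Lemma beta_mem J x t i : closed_walk J x t -> i \in t ->
  beta J x (lo i) = beta J x (hi i).
Proof.
move=> [t_sorted _ conj] it; rewrite /beta -(sortedw_hi t_sorted it).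
have -> : (x^-1 (word_perm t (hi i)) = word_perm J (x^-1 (hi i)))%g.
  rewrite -{1}(permKV x (hi i)); set v := (x^-1 (hi i))%g.
  by rewrite -(permM x) conj permM permK.
exact: (@preserves_word _ J).
Qed.

(** The descent at [i] gives the weak inequality. In case of equality, [lo i] and [hi i] come from
    one block, a cycle of [word_perm J], so [word_perm t] would link them across the gap [i],
    although [i] is not a letter of [t]. *)
Lemma beta_notin J x t i : sortedw J -> closed_walk J x t -> i \notin t ->
  beta J x (hi i) < beta J x (lo i).
Proof.
move=> J_sorted cw; have [t_sorted stay conj] := cw.
move=> it; have [p pt] := stay _ it; rewrite /desc invMg !permM => /ltnW.
move=> /(blk_mono J); rewrite -!/(beta _ _ _).
rewrite !(@word_perm_invariantV _ _ (beta J x)) => [le_b|j /pt jt|j /pt jt];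
  [|exact: beta_mem jt|exact: beta_mem jt].
rewrite ltn_neqAle le_b andbT; apply/eqP => E.
have : (x (x^-1%g (hi i)) <= i) = (x (x^-1%g (lo i)) <= i).
  apply: (@blk_const J _ (fun v => x v <= i)) E => j jJ.
  rewrite -(sortedw_hi J_sorted jJ) -permM -conj permM.
  apply: (@word_perm_invariant _ _ (fun u : 'I_n => u <= i)) => k kt.
  have : k != i by apply: contraNneq it => <-.
  by rewrite -val_eqE /=; lia.
by rewrite !permKV /= ltnn leqnn.
Qed.

Lemma beta_anti J x t : sortedw J -> closed_walk J x t ->
  sorted geq [seq beta J x u | u <- enum 'I_n].
Proof.
move=> J_sorted cw; rewrite sorted_map.
have : sorted (relpre val ltn) (enum 'I_n).
  by rewrite -sorted_map val_enum_ord iota_ltn_sorted.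
apply: sub_sorted => u v /= /ltnW le_uv.
apply: (@ord_chain _ (fun u v => beta J x v <= beta J x u)) => //.
  by move=> b a c ab bc; apply: leq_trans ab.
move=> i _; have [it|it] := boolP (i \in t); first by rewrite (beta_mem cw it).
exact/ltnW/(beta_notin J_sorted cw it).
Qed.

Lemma perm_beta J x :
  perm_eq [seq beta J x u | u <- enum 'I_n] [seq blk J v | v <- enum 'I_n].
Proof.
rewrite /beta (map_comp (blk J)) perm_map //.
apply: uniq_perm; rewrite ?enum_uniq //.
  by rewrite map_inj_uniq ?enum_uniq //; apply: perm_inj.
move=> v; rewrite mem_enum; apply/mapP; exists (x v); rewrite ?mem_enum //.
by rewrite permK.
Qed.

Lemma closed_walk_uniq J x t x' t' : sortedw J ->
  closed_walk J x t -> closed_walk J x' t' ->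
  block_max J x -> block_max J x' -> x = x' /\ t = t'.
Proof.
move=> J_sorted cw cw' xm xm'.
(* Both sequences are the weakly decreasing rearrangement of the block numbers of all positions. *)
have bE u : beta J x u = beta J x' u.
  have : [seq beta J x u | u <- enum 'I_n] = [seq beta J x' u | u <- enum 'I_n].
    apply: (sorted_eq (leT := geq)).
    - by move=> b a c ab bc; apply: leq_trans ab.
    - by move=> a b /= ?; apply/eqP; rewrite eqn_leq andbC.
    - exact: beta_anti cw.
    - exact: beta_anti cw'.
    - by rewrite (perm_trans (perm_beta _ _)) // perm_sym perm_beta.
  by move/eq_in_map => ->; rewrite ?mem_enum.
have memE y s i : closed_walk J y s ->
    (i \in s) = (beta J y (lo i) == beta J y (hi i)).
  move=> cy; have [/(beta_mem cy)->|/(beta_notin J_sorted cy)] := boolP (i \in s).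
    by rewrite eqxx.
  by case: ltngtP.
(* The letters are exactly the places where [beta] does not change. *)
have tE : t = t'.
  apply: (inj_map val_inj); apply: (irr_sorted_eq ltn_trans ltnn).
  - by case: cw.
  - by case: cw'.
  move=> k; have tt' : t =i t' by move=> i; rewrite (memE _ _ _ cw) (memE _ _ _ cw') !bE.
  by apply/mapP/mapP => -[i it ->]; exists i => //; rewrite ?tt' // -tt'.
split=> //; apply/permP => v.
(* Downward induction on [v]. If [v] is [lo i], the closing relation gives [x v] as the image of
   [x (hi i)] under [word_perm t], and [hi i] comes later. *)
have [m] := ubnP (n - v); elim: m v => // m IHm v lt_m.
have [/existsP[i /andP[iJ /eqP vE]]|] := boolP [exists i, (i \in J) && (lo i == v)].
  rewrite -vE -(sortedw_hi J_sorted iJ) -!permM.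
  case: cw cw' => [_ _ <-] [_ _ <-]; rewrite !permM tE IHm //.
  by move: lt_m; rewrite -vE /=; have := ltn_ord (hi i); rewrite /=; lia.
rewrite negb_exists => /forallP v_last.
have vl i : i \in J -> lo i != v by move=> iJ; have := v_last i; rewrite iJ.
(* At the last point of a block, both values are the largest position where the common [beta] has
   the number of this block. *)
have half y y' : block_max J y' -> (forall u, beta J y u = beta J y' u) ->
    y v <= y' v.
  move=> ym yy'; have := ym v (y'^-1%g (y v)) vl.
  by rewrite permKV; apply; rewrite -[LHS]/(beta J y' (y v)) -yy' /beta permK.
by apply/val_inj/eqP; rewrite eqn_leq !half.
Qed.

(* Positions are listed block by block, the blocks in reverse order. *)
Definition rev_ord J u v := (blk J v < blk J u) || (blk J v == blk J u) && (u < v).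

Lemma rev_ord_trans J : transitive (rev_ord J).
Proof. by move=> b a c; rewrite /rev_ord; lia. Qed.

Lemma rev_ord_irr J : irreflexive (rev_ord J).
Proof. by move=> a; rewrite /rev_ord !ltnn andbF. Qed.

Lemma rev_ord_total J u v : u != v -> rev_ord J u v || rev_ord J v u.
Proof. by rewrite /rev_ord -val_eqE /=; lia. Qed.

Lemma rev_rank_subproof J v : #|[pred u | rev_ord J u v]| < n.
Proof.
rewrite -[X in _ < X](card_ord n); apply/proper_card/properP; split.
  exact/subsetP.
by exists v; rewrite // !inE rev_ord_irr.
Qed.

Definition rev_rank J v : 'I_n := Ordinal (rev_rank_subproof J v).

Lemma rev_rank_lt J u v : rev_ord J u v -> rev_rank J u < rev_rank J v.
Proof.
move=> uv; apply/proper_card/properP; split.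
  by apply/subsetP => z; rewrite !inE => zu; apply: rev_ord_trans uv.
by exists u; rewrite !inE ?rev_ord_irr.
Qed.

Lemma rev_rank_inj J : injective (rev_rank J).
Proof.
move=> u v E; apply/eqP/negPn/negP => /(rev_ord_total J).
by case/orP => /rev_rank_lt; rewrite E ltnn.
Qed.

(** The only [x] that contributes: it reverses the order of the blocks and keeps the order inside
    each block. *)
Definition rev_perm J : 'S_n := perm (@rev_rank_inj J).

Lemma rev_perm_lt J u v : (rev_perm J u < rev_perm J v) = rev_ord J u v.
Proof.
rewrite !permE; apply/idP/idP; last exact: rev_rank_lt.
apply: contraTT => uv; rewrite -leqNgt.
have [->//|/(rev_ord_total J)] := eqVneq u v.
by rewrite (negPf uv) => /rev_rank_lt/ltnW.
Qed.

Lemma rev_perm_increasing J : increasing J (rev_perm J).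
Proof.
by move=> i iJ; rewrite rev_perm_lt /rev_ord (blk_adj iJ) eqxx /= ltnSn orbT.
Qed.

Lemma rev_perm_hi J i j : i \in J -> rev_perm J (lo i) = lo j ->
  rev_perm J (hi i) = hi j.
Proof.
move=> iJ /(congr1 val); rewrite !permE /= => E; apply: val_inj => /=; rewrite -E.
(* The points preceding [hi i] in [rev_ord] are [lo i] and the points preceding [lo i], so the rank
   goes up by exactly one. *)
transitivity #|[predU1 lo i & [pred u | rev_ord J u (lo i)]]|.
  apply: eq_card => u; rewrite !inE /rev_ord -(blk_adj iJ).
  have [->|] := eqVneq u (lo i); first by rewrite /= eqxx ltnSn orbT.
  by rewrite -val_eqE /=; lia.
by rewrite cardU1 inE rev_ord_irr.
Qed.

Lemma rev_perm_max J : block_max J (rev_perm J).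
Proof.
move=> v z v_last E; have := blk_last v_last E.
rewrite leq_eqVlt => /orP[/eqP/val_inj->//|lt_zv].
by apply: ltnW; rewrite rev_perm_lt /rev_ord E eqxx lt_zv orbT.
Qed.

(** The letters of [J] transported by [rev_perm J], listed in increasing order. *)
Definition rev_word J : seq 'I_n.-1 :=
  [seq j <- enum 'I_n.-1 | lo j \in [seq rev_perm J (lo i) | i <- J]].

Lemma rev_wordP J j :
  reflect (exists2 i, i \in J & rev_perm J (lo i) = lo j) (j \in rev_word J).
Proof.
rewrite mem_filter mem_enum andbT.
by apply: (iffP mapP) => -[i iJ E]; exists i.
Qed.

Lemma size_rev_word J : uniq J -> size (rev_word J) = size J.
Proof.
move=> J_uniq; rewrite -(size_map (@lo n)) -(size_map (rev_perm J \o @lo n) J).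
apply/perm_size/uniq_perm.
- rewrite map_inj_uniq; last exact: lo_inj.
  by rewrite filter_uniq ?enum_uniq.
- by rewrite map_inj_uniq //; apply: inj_comp; [apply: perm_inj | apply: lo_inj].
move=> u; apply/mapP/mapP => [[j /rev_wordP[i iJ <-] ->]|[i iJ ->]].
  by exists i.
have [j jE] := lo_ex (rev_perm_increasing iJ).
by exists j => //=; apply/rev_wordP; exists i.
Qed.

Lemma beta_rev_word J j : j \in rev_word J ->
  beta J (rev_perm J) (lo j) = beta J (rev_perm J) (hi j).
Proof.
case/rev_wordP => i iJ E.
by rewrite /beta -E -(rev_perm_hi iJ E) !permK blk_adj.
Qed.

(** Across an omitted [j] the block number drops strictly, and the letters of [p] preserve [beta],
    so the descent is there whichever letters were used before. *)
Lemma desc_rev_word J j p : j \notin rev_word J -> {subset p <= rev_word J} ->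
  desc (rev_perm J * word_perm p) j.
Proof.
move=> js ps; rewrite /desc invMg !permM; apply: (@blk_lt_mono _ J).
rewrite -!/(beta _ _ _) !(@word_perm_invariantV _ _ (beta J (rev_perm J)));
  try by move=> i /ps/beta_rev_word.
have : rev_ord J ((rev_perm J)^-1%g (lo j)) ((rev_perm J)^-1%g (hi j)).
  by rewrite -rev_perm_lt !permKV /= ltnSn.
rewrite /beta /rev_ord; set v := _ (lo j); set v' := _ (hi j).
case/orP => // /andP[/eqP E lt_v]; have [i iE] := lo_ex lt_v.
case/negP: js; apply/rev_wordP; exists i; last by rewrite iE permKV.
have iv : i = v :> nat by rewrite -iE.
by apply: (blk_mem (esym E)); rewrite iv leqnn.
Qed.

Lemma closed_walk_rev J : sortedw J -> closed_walk J (rev_perm J) (rev_word J).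
Proof.
move=> J_sorted; have s_sorted : sortedw (rev_word J).
  by apply: sortedw_subseq (enum_sortedw n); apply: filter_subseq.
split=> //.
  move=> j js; exists [::] => //; exact: desc_rev_word.
(* Both sides preserve the blocks and send each [hi i] to [lo i], so [preserves_hi_uniq] applies. *)
have -> : word_perm J = (rev_perm J * word_perm (rev_word J) * (rev_perm J)^-1)%g.
  apply: (@preserves_hi_uniq _ J) => [||i iJ|i iJ].
  - exact: preserves_word.
  - move=> v; rewrite !permM -/(beta _ _ _).
    rewrite (@word_perm_invariant _ _ (beta J (rev_perm J))) => [|j].
      by rewrite /beta permK.
    exact: beta_rev_word.
  - exact: sortedw_hi.
  have [j jE] := lo_ex (rev_perm_increasing iJ).
  rewrite !permM (rev_perm_hi iJ (esym jE)) sortedw_hi ?jE ?permK //.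
  by apply/rev_wordP; exists i.
by rewrite mulgKV.
Qed.

End Walks.

(** * The regular representation *)

Local Open Scope ring_scope.

Section RegularRepresentation.

Variable n : nat.
Implicit Types (i j : 'I_n.-1) (u v w x y c : 'S_n) (s t : seq 'I_n.-1).

(* The order of S_n, in the form n.+1 required by the algebra of matrices. *)
Definition rdim := #|{: 'S_n}|.-1.

Lemma rdimE : #|{: 'S_n}| = rdim.+1.
Proof. by rewrite prednK //; apply/card_gt0P; exists 1%g. Qed.

Definition ix w : 'I_rdim.+1 := cast_ord rdimE (enum_rank w).
Definition unix (a : 'I_rdim.+1) : 'S_n := enum_val (cast_ord (esym rdimE) a).

Lemma ixK : cancel ix unix.
Proof. by move=> w; rewrite /unix cast_ordK enum_rankK. Qed.

Lemma unixK : cancel unix ix.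
Proof. by move=> a; rewrite /ix enum_valK cast_ordKV. Qed.

Definition ebas w : 'rV[{poly int}]_rdim.+1 := delta_mx 0 (ix w).

Lemma ebasE u v : ebas u 0 (ix v) = (u == v)%:R.
Proof. by rewrite mxE eqxx (inj_eq (can_inj ixK)) eq_sym. Qed.

Definition opmx (F : 'S_n -> 'rV[{poly int}]_rdim.+1) : 'M_rdim.+1 :=
  \matrix_(a < rdim.+1) F (unix a).

Lemma ebas_opmx F w : ebas w *m opmx F = F w.
Proof. by rewrite -rowE rowK ixK. Qed.

Lemma ebas_ext (A B : 'M[{poly int}]_rdim.+1) :
  (forall w, ebas w *m A = ebas w *m B) -> A = B.
Proof.
by move=> AB; apply/row_matrixP => a; rewrite !rowE -(unixK a); apply: AB.
Qed.

Lemma ebas_entry (A : 'M[{poly int}]_rdim.+1) u v :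
  A (ix u) (ix v) = (ebas u *m A) 0 (ix v).
Proof. by rewrite -rowE mxE. Qed.

Lemma ebas_sym (A : 'M[{poly int}]_rdim.+1) :
  (forall u v, (ebas u *m A) 0 (ix v) = (ebas v *m A) 0 (ix u)) -> A^T = A.
Proof.
move=> sA; apply/matrixP => a b; rewrite mxE -(unixK a) -(unixK b).
by rewrite !ebas_entry.
Qed.

Definition xif (b : bool) : {poly int} := if b then 'X else 0.

(** Right multiplication by the generator on the basis [T_w]. Matrices act on row vectors from the
    right, so products read in the order of the word. *)
Definition Rmx i : 'M_rdim.+1 :=
  opmx (fun w => ebas (w * simple_refl i)%g + xif (desc w i) *: ebas w).
Definition Jmx : 'M_rdim.+1 := opmx (fun w => ebas w^-1%g).

Lemma ebas_Rmx w i :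
  ebas w *m Rmx i = ebas (w * simple_refl i)%g + xif (desc w i) *: ebas w.
Proof. exact: ebas_opmx. Qed.

Lemma ebas_Jmx w : ebas w *m Jmx = ebas w^-1%g.
Proof. exact: ebas_opmx. Qed.

Lemma Jmx_sqr : Jmx * Jmx = 1.
Proof.
by apply: ebas_ext => w; rewrite -mulmxE mulmxA !ebas_Jmx invgK mulmx1.
Qed.

(** Symmetry makes transposition reverse words, which [Rword_switch] needs to exchange [c] and
    [y]. *)
Lemma Rmx_tr i : (Rmx i)^T = Rmx i.
Proof.
apply: ebas_sym => u v; rewrite !ebas_Rmx.
rewrite mxE [RHS]mxE !ebasE; congr (_ + _); last first.
  rewrite mxE [RHS]mxE !ebasE eq_sym.
  by have [->|] := eqVneq v u; rewrite // !mulr0.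
congr (nat_of_bool _)%:R.
by apply/eqP/eqP => <-; rewrite -mulgA refl_sqr mulg1.
Qed.

Lemma Jmx_tr : Jmx^T = Jmx.
Proof.
apply: ebas_sym => u v; rewrite !ebas_Jmx !ebasE; congr (nat_of_bool _)%:R.
by apply/eqP/eqP => <-; rewrite invgK.
Qed.

Lemma desc_mulr w i j : desc (w * simple_refl i) j =
  (w^-1%g (simple_refl i (hi j)) < w^-1%g (simple_refl i (lo j)))%N.
Proof. by rewrite /desc invMg reflV !permM. Qed.

Lemma desc_same w i : desc (w * simple_refl i) i = ~~ desc w i.
Proof. by rewrite desc_mulr refl_lo refl_hi descNE. Qed.

Lemma xifN b : xif (~~ b) = 'X - xif b.
Proof. by case: b; rewrite /xif /= ?subrr ?subr0. Qed.

Lemma Rmx_quad i : Rmx i * Rmx i = 1 + 'X *: Rmx i.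
Proof.
apply: ebas_ext => w; rewrite -mulmxE mulmxA mulmxDr mulmx1 -scalemxAr.
rewrite !ebas_Rmx mulmxDl -scalemxAl !ebas_Rmx -mulgA refl_sqr mulg1.
rewrite desc_same xifN.
move: (ebas w) (ebas _) => a b; apply/rowP => k; rewrite !mxE.
case: (desc w i); rewrite /xif; ring.
Qed.

Lemma refl_far i j : (i.+1 < j)%N ->
  [/\ simple_refl i (lo j) = lo j, simple_refl i (hi j) = hi j,
      simple_refl j (lo i) = lo i & simple_refl j (hi i) = hi i].
Proof. by move=> lt_ij; split; rewrite refl_id // -val_eqE /=; lia. Qed.

Lemma Rmx_comm i j : (i.+1 < j)%N -> Rmx i * Rmx j = Rmx j * Rmx i.
Proof.
move=> /refl_far[ij1 ij2 ji1 ji2]; apply: ebas_ext => w.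
rewrite -mulmxE !mulmxA !ebas_Rmx !mulmxDl -!scalemxAl !ebas_Rmx.
have sE : (w * simple_refl j * simple_refl i = w * simple_refl i * simple_refl j)%g.
  rewrite -!mulgA; congr (_ * _)%g.
  by rewrite conjgC {3}/simple_refl tpermJ -/(lo j) -/(hi j) ij1 ij2.
rewrite sE !desc_mulr ij1 ij2 ji1 ji2 -!/(desc _ _).
move: (ebas w) (ebas (w * simple_refl i)) (ebas (w * simple_refl j)) => a b c.
move: (ebas _) => d; apply/rowP => k; rewrite !mxE; ring.
Qed.

Lemma Rmx_braid i j : j = i.+1 :> nat ->
  Rmx i * Rmx j * Rmx i = Rmx j * Rmx i * Rmx j.
Proof.
move=> ji; have lj : lo j = hi i by apply: val_inj.
have ip : simple_refl i (hi j) = hi j.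
  by rewrite refl_id // -val_eqE /= ji; lia.
have jp : simple_refl j (lo i) = lo i.
  by rewrite refl_id // -val_eqE /= ji; lia.
have jq : simple_refl j (hi i) = hi j by rewrite -lj refl_lo.
have jr : simple_refl j (hi j) = hi i by rewrite refl_hi lj.
have braid : (simple_refl i * simple_refl j * simple_refl i =
              simple_refl j * simple_refl i * simple_refl j)%g.
  have conjE k l : (simple_refl k * simple_refl l * simple_refl k =
      tperm (simple_refl k (lo l)) (simple_refl k (hi l)))%g.
    by rewrite -tpermJ /conjg reflV mulgA.
  by rewrite !conjE lj refl_hi ip jp jq.
apply: ebas_ext => w.
do 3!rewrite -?mulmxE ?mulmxA ?ebas_Rmx ?mulmxDl -?scalemxAl.
have braidw : (w * simple_refl j * simple_refl i * simple_refl j =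
               w * simple_refl i * simple_refl j * simple_refl i)%g.
  by rewrite -!mulgA; congr (_ * _)%g; rewrite !mulgA.
rewrite !braidw -![(w * simple_refl i * simple_refl i)%g]mulgA.
rewrite -![(w * simple_refl j * simple_refl j)%g]mulgA !refl_sqr !mulg1.
rewrite /desc !invMg !reflV !permM.
do 3!rewrite ?lj ?refl_lo ?refl_hi ?ip ?jp ?jq ?jr.
rewrite (perm_ltN _ (lo_neq_hi i)) (@perm_ltN _ _ (hi i) (hi j)); last first.
  by rewrite -lj lo_neq_hi.
rewrite !xifN; move: (ebas (w * _ * _ * _)) (ebas (w * simple_refl i * _)) => b b1.
move: (ebas (w * simple_refl j * _)) (ebas (w * simple_refl i)) => b2 b3.
move: (ebas (w * _)) (ebas w) => b4 b5; apply/rowP => k; rewrite !mxE.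
(* Of the eight sign patterns of three comparisons, six are orders of three preimages and give
   polynomial identities; the two cyclic ones are contradictory. *)
rewrite /xif; case: ltnP => h1; case: ltnP => h2; case: ltnP => h3; try ring.
- by have := leq_ltn_trans h2 (ltn_trans h1 h3); rewrite ltnn.
- by have := leq_ltn_trans (leq_trans h3 h1) h2; rewrite ltnn.
Qed.

Definition Lmx i : 'M_rdim.+1 :=
  opmx (fun w => ebas (simple_refl i * w)%g + xif (desc w^-1 i) *: ebas w).

Lemma ebas_Lmx w i : ebas w *m Lmx i =
  ebas (simple_refl i * w)%g + xif (desc w^-1 i) *: ebas w.
Proof. exact: ebas_opmx. Qed.

Lemma LmxE i : Lmx i = Jmx * Rmx i * Jmx.
Proof.
apply: ebas_ext => w; rewrite -!mulmxE !mulmxA ebas_Jmx ebas_Rmx mulmxDl.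
by rewrite -scalemxAl !ebas_Jmx invMg !invgK reflV ebas_Lmx.
Qed.

(** The only pair that [simple_refl i] reverses is [lo i], [hi i]. If it were the preimage of
    [lo j], [hi j] under [w], then [simple_refl i] would be the conjugate of [simple_refl j]
    excluded by the hypothesis. *)
Lemma desc_mull w i j : (simple_refl i * w != w * simple_refl j)%g ->
  desc (simple_refl i * w) j = desc w j.
Proof.
move=> ne; rewrite /desc invMg reflV !permM.
have H : simple_refl i != tperm (w^-1%g (lo j)) (w^-1%g (hi j)).
  rewrite -tpermJ conjgE invgK; apply: contra_neq ne => ->.
  by rewrite mulgA mulgKV.
rewrite refl_lt //; apply: contraNneq H => -[-> ->]; last by [].
by rewrite tpermC.
Qed.

(** Checked on each basis vector. If [s_i w = w s_j], the left descent at [i] and the right descent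
    at [j] coincide by length; otherwise neither multiplication affects the descent of the other. *)
Lemma Lmx_Rmx i j : Lmx i * Rmx j = Rmx j * Lmx i.
Proof.
apply: ebas_ext => w; rewrite -!mulmxE !mulmxA ebas_Lmx ebas_Rmx !mulmxDl.
rewrite -!scalemxAl !ebas_Lmx !ebas_Rmx invMg reflV mulgA.
have [E|ne] := eqVneq (simple_refl i * w)%g (w * simple_refl j)%g.
  have dE : desc w j = desc w^-1 i.
    have := descNE w^-1 i; rewrite /desc !invgK -!/(desc _ _) => descN.
    have := inv_num_mull i w; rewrite -descN; have := inv_num_mulr w j.
    rewrite -E; set p := inv_num (_ * _); set q := inv_num _.
    by case: (desc w j); case: ltnP => // _; lia.
  have E' : (simple_refl j * w^-1 = w^-1 * simple_refl i)%g.
    by rewrite -[LHS]invgK invMg invgK reflV -E invMg reflV.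
  by rewrite E' desc_same [X in desc X j]E desc_same !E !xifN dE.
rewrite desc_mull // desc_mull; last first.
  apply: contra_neq ne => E.
  by rewrite -[LHS]invgK invMg reflV -E invMg invgK reflV.
move: (ebas w) (ebas (_ * w * _)%g) (ebas (_ * w)%g) => a b b1.
move: (ebas _) => b2.
by apply/rowP => k; rewrite !mxE; ring.
Qed.

Definition Rword s : 'M_rdim.+1 := \prod_(i <- s) Rmx i.

Lemma Rword_cons i s : Rword (i :: s) = Rmx i * Rword s.
Proof. exact: big_cons. Qed.

Lemma Rword_cat s t : Rword (s ++ t) = Rword s * Rword t.
Proof. exact: big_cat. Qed.

Lemma Rword_rev s : Rword (rev s) = (Rword s)^T.
Proof.
elim: s => [|i s IHs]; first by rewrite /Rword !big_nil trmx1.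
by rewrite rev_cons -cats1 Rword_cat IHs !Rword_cons /Rword big_nil mulr1
  -mulmxE trmx_mul Rmx_tr.
Qed.

(** Conjugation by [Jmx] turns right into left multiplication. The first letter acts first, so the
    letters pile up on the left in reverse order. *)
Definition Lword s : 'M_rdim.+1 := Jmx * Rword s * Jmx.

Lemma Lword_tr s : (Lword s)^T = Lword (rev s).
Proof.
by rewrite /Lword -!mulmxE !trmx_mul Jmx_tr Rword_rev mulmxA.
Qed.

Lemma LwordE s : Lword s = \prod_(i <- s) Lmx i.
Proof.
elim: s => [|i s IHs]; first by rewrite big_nil /Lword /Rword big_nil mulr1 Jmx_sqr.
rewrite big_cons -IHs /Lword LmxE Rword_cons.
by rewrite -!mulrA (mulrA Jmx Jmx) Jmx_sqr mul1r.
Qed.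

Lemma Lword_Rword s t : Lword s * Rword t = Rword t * Lword s.
Proof.
rewrite LwordE; apply: commr_prod => j _; apply/commr_sym/commr_prod => i _.
exact/esym/Lmx_Rmx.
Qed.

Lemma ebas_Rword u s : inv_num (u * word_perm s) = (inv_num u + size s)%N ->
  ebas u *m Rword s = ebas (u * word_perm s)%g.
Proof.
elim: s u => [|i s IHs] u; first by rewrite /Rword big_nil mulmx1 word_perm_nil mulg1.
rewrite word_perm_cons Rword_cons -mulmxE mulmxA mulgA /= => E.
have := inv_num_word_le (u * simple_refl i) s; have := inv_num_mulr u i.
rewrite E; set p := inv_num (_ * _) => pE le_p.
have dF : desc u i = false by move: pE; case: desc => //=; lia.
rewrite ebas_Rmx dF scale0r addr0 IHs // E -/p; move: pE; rewrite dF /=; lia.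
Qed.

Lemma ebas1_reduced x : ebas 1%g *m Rword (reduced_word x) = ebas x.
Proof.
have [xE sE] := reduced_wordP x.
by rewrite ebas_Rword mul1g xE // sE inv_num1 coxlen_inv_num.
Qed.

Lemma ebas_reduced u x : inv_num (u * x) = (inv_num u + inv_num x)%N ->
  ebas u *m Rword (reduced_word x) = ebas (u * x)%g.
Proof.
have [xE sE] := reduced_wordP x.
by move=> E; rewrite ebas_Rword xE // sE coxlen_inv_num.
Qed.

Lemma ebas1_reduced_rev x : ebas 1%g *m Rword (rev (reduced_word x)) = ebas x^-1%g.
Proof.
have [xE sE] := reduced_wordP x.
by rewrite ebas_Rword mul1g word_perm_rev xE //
  inv_num1 inv_numV size_rev sE coxlen_inv_num.
Qed.

(** Write [ebas x^-1] and [ebas x] as left multiples of [ebas 1] and move the left multiplications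
    last. The two sides become the [(y, c)] entry of [Lword r] and the [(c, y)] entry of its
    transpose. *)
Lemma Rword_switch x y c s t :
  ebas 1%g *m Rword s = ebas y -> ebas 1%g *m Rword t = ebas c ->
  (ebas x^-1%g *m Rword s) 0 (ix c) = (ebas x *m Rword t) 0 (ix y).
Proof.
move=> sy tc; set r := reduced_word x.
have L1 : ebas 1%g *m Lword r = ebas x^-1%g.
  by rewrite /Lword -!mulmxE !mulmxA ebas_Jmx invg1 ebas1_reduced ebas_Jmx.
have L1' : ebas 1%g *m Lword (rev r) = ebas x.
  by rewrite /Lword -!mulmxE !mulmxA ebas_Jmx invg1 ebas1_reduced_rev ebas_Jmx invgK.
have LR t1 t2 : Lword t1 *m Rword t2 = Rword t2 *m Lword t1.
  exact: Lword_Rword.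
rewrite -L1 -L1' -(mulmxA _ (Lword r)) -(mulmxA _ (Lword (rev r))) !LR.
rewrite (mulmxA _ (Rword s)) (mulmxA _ (Rword t)) sy tc.
by rewrite -!ebas_entry -Lword_tr [RHS]mxE.
Qed.

Lemma ebas_walks x s : ebas x *m Rword s =
  \sum_(t <- walks x s) 'X^(size s - size t) *: ebas (x * word_perm t)%g.
Proof.
elim: s x => [|i s IHs] x.
  by rewrite /Rword big_nil mulmx1 big_seq1 word_perm_nil mulg1 scale1r.
rewrite Rword_cons -mulmxE mulmxA ebas_Rmx mulmxDl -scalemxAl !IHs /=.
rewrite big_cat big_map /=; congr (_ + _).
  by apply: eq_bigr => t _; rewrite word_perm_cons mulgA subSS.
rewrite /xif; case: (desc x i); last by rewrite big_nil scale0r.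
rewrite scaler_sumr big_seq [RHS]big_seq; apply: eq_bigr => t /walks_subseq.
move=> /size_subseq le_t; rewrite scalerA -exprS; congr (_ *: _).
by rewrite subSn.
Qed.

End RegularRepresentation.

(** * Coefficients of class elements and of relative norms *)

Section CoxeterElement.

Variable n : nat.
Implicit Types (i j : 'I_n.-1) (u v : 'I_n) (w x d e : 'S_n).

Definition cox_elt : 'S_n := word_perm (enum 'I_n.-1).

(** [cox_elt] sends every [hi i] to [lo i], so an invariant function agrees at neighbouring
    positions. This is how its transitivity is used. *)
Lemma cox_elt_const (T : eqType) (f : 'I_n -> T) u v :
  (forall z, f (cox_elt z) = f z) -> f u = f v.
Proof.
move=> fc; have f_adj i : f (lo i) = f (hi i).
  by rewrite -(fc (hi i)) sortedw_hi ?mem_enum //; apply: enum_sortedw.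
wlog le_uv : u v / (u <= v)%N => [IH|].
  by have [/IH//|/ltnW/IH/esym] := leqP u v.
apply/eqP; apply: (@ord_chain _ (fun u v => f u == f v)) => //.
- by move=> b a c /eqP->.
- by move=> i _; rewrite f_adj.
Qed.

Lemma porbits_cox_elt : (0 < n)%N -> porbits cox_elt = [set [set: 'I_n]].
Proof.
move=> n_gt0; have orbT v : porbit cox_elt v = [set: 'I_n].
  apply/setP => u; rewrite inE.
  rewrite (@cox_elt_const _ (porbit cox_elt) v u) ?porbit_id // => z.
  by have := porbit_perm cox_elt 1 z; rewrite expg1.
apply/setP => A; rewrite inE; apply/imsetP/eqP => [[v _ ->]|->]; first exact: orbT.
by exists (Ordinal n_gt0); rewrite ?orbT.
Qed.

Lemma cycle_type_cox_elt : (0 < n)%N -> cycle_type cox_elt = [:: n].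
Proof.
by move=> n_gt0; rewrite /cycle_type porbits_cox_elt // enum_set1 /= cardsT card_ord.
Qed.

Lemma min_in_class_cox_elt : min_in_class cox_elt.
Proof.
apply/forall_inP => v /imsetP[z _ vE].
have le_c : (coxlen cox_elt <= n.-1)%N.
  by apply: (leq_trans (coxlen_min _)); rewrite size_enum_ord.
apply: (leq_trans le_c); rewrite leqNgt; apply/negP => lt_v.
have [sE sz] := reduced_wordP v; set s := reduced_word v in sE sz.
have [j js] : exists j, j \notin s.
  case: (pickP [pred j | j \notin s]) => [j js|sT]; first by exists j.
  move: lt_v; rewrite -sz ltnNge -{1}(size_enum_ord n.-1) uniq_leq_size ?enum_uniq //.
  by move=> j _; have /negbFE := sT j.
(* A conjugate missing the letter [j] respects the test [u <= j]; transported by [z], this test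
   would be a nonconstant invariant of [cox_elt]. *)
have := @cox_elt_const _ (fun u => z u <= j)%N (z^-1%g (lo j)) (z^-1%g (hi j)).
rewrite !permKV /= leqnn ltnn => H; suff: true = false by [].
apply: H => u; rewrite -permJ -vE -sE.
apply: (@word_perm_invariant _ _ (fun u : 'I_n => u <= j)%N) => k ks.
have : k != j by apply: contraNneq js => <-.
by rewrite -val_eqE /=; lia.
Qed.

End CoxeterElement.

(** * Parabolic subgroups and distinguished coset representatives *)

Section Parabolic.

Variable n : nat.
Implicit Types (i j : 'I_n.-1) (u v : 'I_n) (w x d e : 'S_n) (la : seq nat).

Lemma block_positions_bound off la k : k \in block_positions off la ->
  (off <= k)%N /\ (k.+1 < off + sumn la)%N.
Proof.
elim: la off => //= l la IHla off; rewrite mem_cat mem_iota.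
case/orP => [|/IHla]; lia.
Qed.

Lemma block_positions_sorted off la : sorted ltn (block_positions off la).
Proof.
elim: la off => //= l la IHla off.
rewrite (sorted_pairwise ltn_trans) pairwise_cat -!(sorted_pairwise ltn_trans).
rewrite iota_ltn_sorted IHla !andbT; apply/allrelP => a b.
by rewrite mem_iota => ? /block_positions_bound; lia.
Qed.

(** Passing to [comp_pred la] drops the last letter of each block, so the successor of a remaining
    letter is still a letter for [la]. *)
Lemma comp_pred_positions off la k : k \in block_positions off (comp_pred la) ->
  k \in block_positions off la /\ k.+1 \in block_positions off la.
Proof.
rewrite /comp_pred; elim: la off => //= l la IHla off.
case: ifP => [l_gt1|l_le1] /=; last first.
  by rewrite !mem_cat => /orP[|/IHla[-> ->]]; rewrite ?orbT // mem_iota; lia.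
rewrite mem_cat => /orP[|].
  by rewrite !mem_cat !mem_iota => ?; split; apply/orP; left; lia.
have -> : (off + l.-1 + 1 = off + l)%N by lia.
by move=> /IHla; rewrite !mem_cat => -[-> ->]; rewrite !orbT.
Qed.

Lemma parabolic_gens_sorted la : sortedw (parabolic_gens n la).
Proof.
rewrite /sortedw /parabolic_gens (pmap_filter (insubK _)).
by apply: subseq_sorted (block_positions_sorted 0 la);
  [apply: ltn_trans | apply: filter_subseq].
Qed.

Lemma mem_parabolic_gens la i :
  (i \in parabolic_gens n la) = (val i \in block_positions 0 la).
Proof. exact: mem_pmap_sub. Qed.

Lemma comp_pred_gens la i : sumn la = n -> i \in parabolic_gens n (comp_pred la) ->
  i \in parabolic_gens n la /\
  exists2 j, j \in parabolic_gens n la & lo j = hi i.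
Proof.
move=> la_n; rewrite !mem_parabolic_gens => /comp_pred_positions[i1 i2]; split=> //.
have lt_i : (i.+1 < n.-1)%N by have := block_positions_bound i2; rewrite la_n /=; lia.
by exists (Ordinal lt_i); [rewrite mem_parabolic_gens | apply: val_inj].
Qed.

Lemma parabolic_ind la (P : 'S_n -> Prop) : P 1%g ->
  (forall x y, P x -> P y -> P (x * y)%g) ->
  (forall i, i \in parabolic_gens n la -> P (simple_refl i)) ->
  forall x, x \in parabolic n la -> P x.
Proof.
move=> P1 PM Pg x /gen_prodgP[m [c cP ->]]; apply: (big_ind P) => // k _.
by have /imsetP[i ig ->] := cP k; apply: Pg.
Qed.

Lemma parabolic_preserves la x : x \in parabolic n la ->
  preserves (parabolic_gens n la) x.
Proof.
apply: parabolic_ind => [|y z|i ig].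
- exact: preserves1.
- exact: preservesM.
have -> : simple_refl i = word_perm [:: i] by rewrite word_perm_cons word_perm_nil mulg1.
by apply: preserves_word => j; rewrite inE => /eqP->.
Qed.

Lemma refl_parabolic la i : i \in parabolic_gens n la ->
  simple_refl i \in parabolic n la.
Proof. by move=> ig; apply/mem_gen/imset_f. Qed.

Lemma dist_reps_increasing la d :
  d \in dist_reps [set: 'S_n] (parabolic n la) -> increasing (parabolic_gens n la) d.
Proof.
rewrite inE => /andP[_ /forall_inP d_min] i ig.
have := d_min (simple_refl i * d)%g; rewrite !coxlen_inv_num.
move=> /(_ _)/wrap[]; first exact/imset2_f/set11/refl_parabolic.
have := inv_num_mull i d; set p := inv_num (_ * _).
by rewrite (perm_ltN _ (lo_neq_hi i)); case: (d _ < _)%N; lia.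
Qed.

Lemma dist_reps_rev la :
  rev_perm (parabolic_gens n la) \in dist_reps [set: 'S_n] (parabolic n la).
Proof.
rewrite inE in_setT; apply/forall_inP => v /mulsgP[k x kla /set1P-> ->].
rewrite !coxlen_inv_num.
by rewrite (inv_num_mul (parabolic_preserves kla)) ?leq_addl //;
  apply: rev_perm_increasing.
Qed.

Lemma dist_reps1 (G : {set 'S_n}) : dist_reps G 1%g = G.
Proof.
apply/setP => d; rewrite inE; case: (d \in G) => //=.
by apply/forall_inP => v /mulsgP[k x /set1P-> /set1P-> ->]; rewrite mul1g.
Qed.

(** For a generator [i] of the smaller subgroup, both [lo i] and [hi i = lo j] lie before the end of
    their block, so last points stay fixed. *)
Lemma comp_pred_parabolic la e : sumn la = n -> e \in parabolic n (comp_pred la) ->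
  preserves (parabolic_gens n la) e /\
  forall v, (forall i, i \in parabolic_gens n la -> lo i != v) -> e v = v.
Proof.
move=> la_n e_la; split.
  move: e e_la; apply: parabolic_ind => [|y z|i ig].
  - exact: preserves1.
  - exact: preservesM.
  have [iJ _] := comp_pred_gens la_n ig.
  exact/parabolic_preserves/refl_parabolic.
move: e e_la; apply: parabolic_ind => [v _|y z yP zP v v_last|i ig v v_last].
- exact: perm1.
- by rewrite permM yP ?zP.
have [iJ [j jJ jE]] := comp_pred_gens la_n ig.
rewrite refl_id // eq_sym; first exact: v_last.
by rewrite -jE v_last.
Qed.

(** This makes the lengths of [w_la] and of [e] in the parabolic subgroup of [comp_pred la] add up
    in [w_la * e]. *)
Lemma parabolic_coxV_increasing la : sumn la = n ->
  increasing (parabolic_gens n (comp_pred la)) (parabolic_cox n la)^-1%g.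
Proof.
move=> la_n i ig; have [iJ [j jJ jE]] := comp_pred_gens la_n ig.
have VE k : k \in parabolic_gens n la -> (parabolic_cox n la)^-1%g (lo k) = hi k.
  move=> kJ; rewrite -(sortedw_hi (parabolic_gens_sorted la) kJ) permK //.
rewrite -jE !VE //; move/(congr1 val): jE => /=; lia.
Qed.

Lemma coxlen_parabolic_cox la :
  coxlen (parabolic_cox n la) = size (parabolic_gens n la).
Proof. by rewrite coxlen_inv_num sortedw_inv_num //; apply: parabolic_gens_sorted. Qed.

Lemma parabolic_block_max la e d : sumn la = n ->
  e \in parabolic n (comp_pred la) -> increasing (parabolic_gens n la) d ->
  block_max (parabolic_gens n la) (e * d).
Proof.
move=> la_n /(comp_pred_parabolic la_n)[eJ e_last] d_inc v z v_last E.
have E' : blk (parabolic_gens n la) (e z) = blk (parabolic_gens n la) v by rewrite eJ.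
rewrite !permM (e_last _ v_last) leqNgt (increasing_mono d_inc) //.
by rewrite -leqNgt (blk_last v_last).
Qed.

End Parabolic.

(** * Coefficients read off the regular representation *)

Section Coefficients.

Variables (n : nat) (H : algType {poly int}) (g : 'I_n.-1 -> H).
Variable f : {lrmorphism H -> 'M[{poly int}]_((rdim n).+1)}.
Hypothesis fg : forall i, f (g i) = Rmx i.

Implicit Types (c w x d e : 'S_n).

(** The coordinate at [c] of the image of [T_1] under [h]; by [coef_T] it extracts the coefficient
    of [T_c] from a combination of the [T_w]. *)
Definition coef c (h : H) : {poly int} := (ebas 1%g *m f h) 0 (ix c).

Lemma coefD c h1 h2 : coef c (h1 + h2) = coef c h1 + coef c h2.
Proof. by rewrite /coef raddfD mulmxDr mxE. Qed.

Lemma coefZ c a h : coef c (a *: h) = a * coef c h.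
Proof. by rewrite /coef linearZ -scalemxAr mxE. Qed.

Lemma coef_sum c (I : finType) (P : pred I) (F : I -> H) :
  coef c (\sum_(i | P i) F i) = \sum_(i | P i) coef c (F i).
Proof. by rewrite /coef raddf_sum mulmx_sumr summxE. Qed.

Lemma hecke_TE w : f (hecke_T g w) = Rword (reduced_word w).
Proof. by rewrite rmorph_prod; apply: eq_bigr => i _; apply: fg. Qed.

Lemma coef_T c w : coef c (hecke_T g w) = (w == c)%:R.
Proof. by rewrite /coef hecke_TE ebas1_reduced ebasE. Qed.

Lemma coef_class_element (la : seq nat) (z : H) (c : 'S_n) :
  min_in_class c -> is_class_element g la z -> coef c z = (c \in type_class n la)%:R.
Proof.
move=> c_min [_ _ [q zE q_min]].
rewrite -[z](subrK (\sum_(w in type_class n la) hecke_T g w)) zE coefD !coef_sum.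
rewrite big1 ?add0r => [|w _]; last first.
  rewrite coefZ coef_T; have [->|] := eqVneq w c; last by rewrite mulr0.
  by rewrite q_min // mul0r.
under eq_bigr => w _ do rewrite coef_T.
have [cla|cla] := boolP (c \in _).
  rewrite (bigD1 c) //= eqxx big1 ?addr0 // => w /andP[_ /negPf->] //.
by rewrite big1 // => w wla; case: eqP => // wc; rewrite -wc wla in cla.
Qed.

Lemma coef_conj (la : seq nat) (la_n : sumn la = n) e d :
  e \in parabolic n (comp_pred la) -> increasing (parabolic_gens n la) d ->
  coef (cox_elt n) (hecke_T g d^-1%g *
      (hecke_T g e^-1%g * hecke_T g (parabolic_cox n la) * hecke_T g e) *
      hecke_T g d) =
  \sum_(t <- walks (e * d) (enum 'I_n.-1))
     'X^(n.-1 - size t) *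
     (e * d * word_perm t == parabolic_cox n la * (e * d))%g%:R.
Proof.
move=> e_la d_inc; set w := parabolic_cox n la.
have [eJ _] := comp_pred_parabolic la_n e_la.
have wJ : preserves (parabolic_gens n la) w by apply: preserves_word.
have len_ed : inv_num (e * d) = (inv_num e + inv_num d)%N.
  exact: inv_num_mul eJ d_inc.
have len_we : inv_num (w * e) = (inv_num w + inv_num e)%N.
  rewrite -inv_numV invMg (inv_num_mul (preservesV (parabolic_preserves e_la))).
    by rewrite !inv_numV addnC.
  exact: parabolic_coxV_increasing.
have len_wed : inv_num (w * e * d) = (inv_num (w * e) + inv_num d)%N.
  exact: inv_num_mul (preservesM wJ eJ) d_inc.
rewrite /coef !rmorphM /= !hecke_TE -!mulrA -!mulmxE !mulmxA ebas1_reduced.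
rewrite ebas_reduced; last first.
  by rewrite -invMg !inv_numV addnC.
rewrite -invMg -!mulmxA !mulmxE -!Rword_cat.
(* The additive lengths have merged the left factors into [T_(x^-1)] with [x = e * d], and merge the
   right ones into [T_(w x)]. The switch leaves [T_x T_c], which the walks expand. *)
rewrite (@Rword_switch _ _ (w * (e * d))%g _ _ (enum 'I_n.-1)).
- rewrite ebas_walks summxE; apply: eq_bigr => t _.
  by rewrite mxE ebasE size_enum_ord.
- rewrite !Rword_cat -!mulmxE !mulmxA ebas1_reduced ebas_reduced //.
  by rewrite ebas_reduced // mulgA.
rewrite ebas_Rword mul1g // inv_num1 sortedw_inv_num //; exact: enum_sortedw.
Qed.

Lemma coef_b_elt (la : seq nat) : sumn la = n ->
  coef (cox_elt n) (b_elt g la) = 'X^(n.-1 - coxlen (parabolic_cox n la)).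
Proof.
move=> la_n; rewrite coxlen_parabolic_cox /b_elt /Defs.eta /rel_norm dist_reps1.
set J := parabolic_gens n la.
have J_sorted : sortedw J := parabolic_gens_sorted n la.
have cwR := closed_walk_rev J_sorted.
(* Every nonzero term yields a closed walk with [block_max], hence the one found for
   [rev_perm J]. *)
have F0 e d t : e \in parabolic n (comp_pred la) -> increasing J d ->
    t \in walks (e * d)%g (enum 'I_n.-1) ->
    (e * d * word_perm t == parabolic_cox n la * (e * d))%g ->
    (e * d)%g = rev_perm J /\ t = rev_word J.
  move=> e_la d_inc tw /eqP conj.
  apply: (closed_walk_uniq J_sorted) => //.
  - split=> //.
      by apply: sortedw_subseq (enum_sortedw n); apply: walks_subseq tw.
    by move=> i it; apply: (walks_stay tw); rewrite ?mem_enum.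
  - exact: parabolic_block_max.
  - exact: rev_perm_max.
have P1 : 1%g \in parabolic n (comp_pred la) by apply: group1.
have DJ := @dist_reps_increasing n la; have Drev := dist_reps_rev n la.
under eq_bigr => d _ do rewrite mulr_sumr mulr_suml.
rewrite coef_sum (bigD1 (rev_perm J)) //= coef_sum (bigD1 1%g) //=.
rewrite coef_conj //; last exact: DJ.
rewrite mul1g (bigD1_seq (rev_word J)) /=; last 2 first.
- have -> : rev_word J = [seq i <- enum 'I_n.-1 | i \in rev_word J].
    by apply: eq_filter => i; rewrite mem_filter mem_enum andbT.
  by apply: walks_filter => i p; apply: desc_rev_word.
- exact/walks_uniq/enum_uniq.
have [_ _ ->] := cwR; rewrite eqxx mulr1 size_rev_word ?sortedw_uniq //.
rewrite big_seq_cond big1 => [|t /andP[tw tN]]; last first.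
  case: eqP => [/eqP conj|]; rewrite ?mulr0 //.
  have [||_ /eqP] := F0 1%g (rev_perm J) t P1 (DJ _ Drev); rewrite ?mul1g //.
  by rewrite (negPf tN).
(* If [e * d] is [rev_perm J], lengths add both in [e * d] and in [d = e^-1 * rev_perm J], so [e]
   has length 0. *)
have Z e d : e \in parabolic n (comp_pred la) ->
    d \in dist_reps [set: 'S_n] (parabolic n la) -> (e != 1%g) || (d != rev_perm J) ->
    coef (cox_elt n) (hecke_T g d^-1%g *
      (hecke_T g e^-1%g * hecke_T g (parabolic_cox n la) * hecke_T g e) *
      hecke_T g d) = 0.
  move=> e_la dD ne; rewrite coef_conj //; last exact: DJ.
  rewrite big_seq big1 // => t tw; case: eqP => [/eqP conj|]; rewrite ?mulr0 //.
  have [edE _] := F0 e d t e_la (DJ _ dD) tw conj.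
  have [eJ _] := comp_pred_parabolic la_n e_la.
  have dE : d = (e^-1 * rev_perm J)%g by rewrite -edE mulKg.
  have len1 := inv_num_mul eJ (DJ _ dD).
  have len2 := inv_num_mul (preservesV eJ) (DJ _ Drev).
  rewrite edE in len1; rewrite -dE inv_numV in len2.
  have e1 : e = 1%g.
    by apply: inv_num_eq0; move: len1; rewrite len2; move: (inv_num _) => m; lia.
  by move: ne; rewrite dE e1 invg1 mul1g !eqxx.
rewrite big1 => [|e /andP[e_la e1]]; last by rewrite Z // e1.
rewrite big1 ?addr0 // => d /andP[dD d1].
by rewrite coef_sum big1 // => e e_la; rewrite Z // d1 orbT.
Qed.

End Coefficients.

Theorem theorem7p4 (n : nat) (n_gt0 : (0 < n)%N)
    (H : algType {poly int}) (g : 'I_n.-1 -> H) (hH : is_hecke g)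
    (Gamma : intpart n -> H)
    (hGamma : forall la : intpart n, is_class_element g la (Gamma la))
    (alpha : intpart n) (c : intpart n -> {poly int})
    (hc : b_elt g alpha = \sum_(la : intpart n) c la *: Gamma la) :
  c (row_part n_gt0) = 'X ^+ (n.-1 - coxlen (parabolic_cox n alpha)).
Proof.
have [_ univ _] := hH; have [f fg] : exists f : {lrmorphism H -> 'M[{poly int}]_((rdim n).+1)},
    forall i, f (g i) = Rmx i.
  apply: univ; split; [exact: Rmx_comm | exact: Rmx_braid | exact: Rmx_quad].
have alpha_n : sumn alpha = n by case: alpha {hc} => /= la /and3P[_ _ /eqP].
rewrite -(coef_b_elt fg alpha_n) hc coef_sum (bigD1 (row_part n_gt0)) //=.
(* The Coxeter element has minimal length in its class and cycle type [(n)], so it detects only the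
   class element of [row_part]. *)
have GE la : coef f (cox_elt n) (Gamma la) = (la == row_part n_gt0)%:R.
  rewrite (coef_class_element fg (min_in_class_cox_elt n) (hGamma la)).
  by rewrite inE cycle_type_cox_elt // eq_sym.
rewrite coefZ GE eqxx mulr1 big1 ?addr0 // => la /negPf la_neq.
by rewrite coefZ GE la_neq mulr0.
Qed.
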